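(* Let $G, H$ be simple graphs such that $\chi(G)\geq 2$ and $\omega(H)=\chi(H)\geq 2$. Then $$\mathrm{C}(G;H)=\min\{k\ge 1:~\chi(G)\leq \left(\chi(H)\right)^k\}=\lceil\log_{\chi(H)}\chi(G) \rceil.$$ Moreover, the equalities $$\mathrm{C}(G;H)=\max\{m\ge 1:~\left(\chi(H)\right)^{m-1}+1\leq \chi(G)\}=\lfloor \log_{\chi(H)}\left(\chi(H)\left(\chi(G)-1\right)\right)\rfloor$$ also hold.
   Context: A simple graph is an undirected graph without loops and without multiple edges. A homomorphism $f:G\to H$ is a map $f:V(G)\to V(H)$ with $f(u)f(v)\in E(H)$ whenever $uv\in E(G)$. A subgraph of $G$ is a graph whose vertex and edge sets are subsets of $V(G)$, $E(G)$. The union $G_1\cup\cdots\cup G_k$ has vertex set $\bigcup_i V(G_i)$ and edge set $\bigcup_i E(G_i)$. $\chi$ denotes the chromatic number and $\omega(H)=\max\{j:~K_j\text{ is (isomorphic to) a subgraph of }H\}$ the clique number; these numbers are finite for the graphs considered. $k$ and $m$ range over integers. The hom-complexity $\mathrm{C}(G;H)$ is the least positive integer $k$ such that there are subgraphs $G_1,\dots,G_k$ of $G$ with $G=G_1\cup\cdots\cup G_k$ and, for each $i$, a homomorphism $G_i\to H$; $\mathrm{C}(G;H)=\infty$ if no such $k$ exists. *)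

(* Defs.v *)
From mathcomp Require Import all_boot all_order all_algebra.
From mathcomp Require Import all_classical reals exp.

Set Implicit Arguments.
Unset Strict Implicit.
Unset Printing Implicit Defensive.

Local Open Scope classical_set_scope.

(* Vertices form a subset of an ambient type [T] (not assumed finite), so that
   subgraphs and unions of graphs are compared inside [T]; the edge [uv] is
   encoded as the symmetric pair [edge u v], [edge v u]. *)
Record sgraph (T : Type) := SGraph {
  vertices : set T;
  edge : T -> T -> Prop;
  edge_vertices : forall u v, edge u v -> vertices u;
  edge_sym : forall u v, edge u v -> edge v u;
  edge_irrefl : forall u, ~ edge u u }.

Lemma sgraph_ext (T : Type) (G H : sgraph T) :
  vertices G = vertices H -> (forall u v, edge G u v <-> edge H u v) -> G = H.
Proof.
case: G => VG EG vG sG iG; case: H => VH EH vH sH iH /= eV eE.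
have {}eE : EG = EH by apply/funext => u; apply/funext => v; apply/propext.
by subst; congr SGraph; apply: Prop_irrelevance.
Qed.

Definition subgraph (T : Type) (G H : sgraph T) : Prop :=
  vertices G `<=` vertices H /\ (forall u v, edge G u v -> edge H u v).

Section Union.
Variables (T I : Type) (G_ : I -> sgraph T).

Definition union_edge (u v : T) : Prop := exists i, edge (G_ i) u v.

Let union_edge_vertices u v :
  union_edge u v -> (\bigcup_i vertices (G_ i)) u.
Proof. by move=> [i uv]; exists i => //; exact: edge_vertices uv. Qed.

Let union_edge_sym u v : union_edge u v -> union_edge v u.
Proof. by move=> [i uv]; exists i; exact: edge_sym. Qed.

Let union_edge_irrefl u : ~ union_edge u u.
Proof. by move=> [i uu]; exact: edge_irrefl uu. Qed.

Definition graph_union : sgraph T :=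
  SGraph union_edge_vertices union_edge_sym union_edge_irrefl.

End Union.

Section Complete.
Variable n : nat.

Let complete_edge (i j : 'I_n) : Prop := i <> j.

Let complete_edge_vertices i j : complete_edge i j -> [set: 'I_n] i.
Proof. by []. Qed.

Let complete_edge_sym i j : complete_edge i j -> complete_edge j i.
Proof. exact: nesym. Qed.

Let complete_edge_irrefl i : ~ complete_edge i i.
Proof. by apply. Qed.

Definition complete_graph : sgraph 'I_n :=
  SGraph complete_edge_vertices complete_edge_sym complete_edge_irrefl.

End Complete.

Definition is_hom (T T' : Type) (G : sgraph T) (H : sgraph T')
    (f : vertices G -> vertices H) : Prop :=
  forall u v : vertices G,
    edge G (\val u) (\val v) -> edge H (\val (f u)) (\val (f v)).

Definition homomorphic (T T' : Type) (G : sgraph T) (H : sgraph T') : Prop :=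
  exists f : vertices G -> vertices H, is_hom f.

Definition isomorphic (T T' : Type) (G : sgraph T) (H : sgraph T') : Prop :=
  exists2 f : vertices G -> vertices H, bijective f &
    forall u v : vertices G,
      edge G (\val u) (\val v) <-> edge H (\val (f u)) (\val (f v)).

(* [None] when the minimum does not exist, i.e. when [A] is empty. *)
Definition min_nat (A : set nat) : option nat :=
  xget None [set Some k | k in A `&` lbound A].

(* [None] when the maximum does not exist, i.e. when [A] is empty or
   unbounded. *)
Definition max_nat (A : set nat) : option nat :=
  xget None [set Some k | k in A `&` ubound A].

Definition colorable (T : Type) (G : sgraph T) (n : nat) : Prop :=
  exists c : vertices G -> 'I_n,
    forall u v : vertices G, edge G (\val u) (\val v) -> c u <> c v.

(* [None] stands for an infinite chromatic number. *)
Definition chromatic_number (T : Type) (G : sgraph T) : option nat :=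
  min_nat [set n | colorable G n].

(* [None] stands for an infinite clique number. *)
Definition clique_number (T : Type) (H : sgraph T) : option nat :=
  max_nat [set j | exists2 K : sgraph T,
                     subgraph K H & isomorphic (complete_graph j) K].

(* [None] stands for infinite hom-complexity. *)
Definition hom_complexity (T T' : Type) (G : sgraph T) (H : sgraph T')
    : option nat :=
  min_nat [set k | (1 <= k)%N /\ exists G_ : 'I_k -> sgraph T,
    [/\ forall i, subgraph (G_ i) G,
        G = graph_union G_ &
        forall i, homomorphic (G_ i) H]].

Definition log_base (R : realType) (b x : R) : R := (ln x / ln b)%R.

(* Main.v *)
(* A cover of G by k subgraphs mapping into H gives, by composing with a
   χ(H)-colouring of H, a k-tuple of colours at every vertex, i.e. a colouring
   of G with χ(H)^k colours.  Conversely, as H contains the complete graph on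
   χ(H) vertices, each coordinate of a colouring of G by k-tuples defines a
   subgraph of G (the edges on which that coordinate changes) mapping into H.
   Hence G has a cover of size k iff χ(G) <= χ(H)^k, and all the remaining
   expressions are determined by χ(H)^(C-1) < χ(G) <= χ(H)^C. *)
Require Import Defs.
From mathcomp Require Import all_boot all_order all_algebra.
From mathcomp Require Import all_classical reals exp.
Import Order.TTheory GRing.Theory Num.Theory.

Set Implicit Arguments.
Unset Strict Implicit.

Local Open Scope classical_set_scope.
Local Open Scope ring_scope.

(** Two minima bound each other, so the value picked by [xget] is unique; this replaces the choice
    operator by a usable characterization. *)
Lemma min_natE (A : set nat) (k : nat) :
  min_nat A = Some k <-> A k /\ forall j, A j -> (k <= j)%N.
Proof.
rewrite /min_nat; split=> [|[Ak kA]].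
  by case: xgetP => // _ -> [j [Aj jA] <-] [<-]; split.
case: xgetP => [_ -> [j [Aj jA] <-]|/(_ (Some k)) []]; last by exists k.
by congr Some; apply/eqP; rewrite eqn_leq kA // andbT; exact: jA.
Qed.

Lemma max_natE (A : set nat) (k : nat) :
  max_nat A = Some k <-> A k /\ forall j, A j -> (j <= k)%N.
Proof.
rewrite /max_nat; split=> [|[Ak Ak_le]].
  by case: xgetP => // _ -> [j [Aj Aj_le] <-] [<-]; split.
case: xgetP => [_ -> [j [Aj Aj_le] <-]|/(_ (Some k)) []]; last by exists k.
by congr Some; apply/eqP; rewrite eqn_leq Ak_le //=; exact: Aj_le.
Qed.

Lemma homomorphic_trans (T1 T2 T3 : Type) (G1 : sgraph T1) (G2 : sgraph T2)
    (G3 : sgraph T3) :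
  homomorphic G1 G2 -> homomorphic G2 G3 -> homomorphic G1 G3.
Proof.
by move=> [f fhom] [g ghom]; exists (g \o f) => u v /fhom /ghom.
Qed.

Lemma isomorphic_homomorphic (T T' : Type) (G : sgraph T) (H : sgraph T') :
  isomorphic G H -> homomorphic G H.
Proof. by move=> [f _ fE]; exists f => u v /fE. Qed.

Lemma subgraph_homomorphic (T : Type) (G H : sgraph T) :
  subgraph G H -> homomorphic G H.
Proof.
move=> [GH_v GH_e].
by exists (fun u => exist _ (\val u) (mem_set (GH_v _ (set_valP u)))) => u v /GH_e.
Qed.

Lemma clique_number_homomorphic (T : Type) (H : sgraph T) (n : nat) :
  clique_number H = Some n -> homomorphic (complete_graph n) H.
Proof.
move=> /max_natE[[K KH /isomorphic_homomorphic nK] _].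
exact: homomorphic_trans nK (subgraph_homomorphic KH).
Qed.

Lemma chromatic_number_le (T : Type) (G : sgraph T) (n m : nat) :
  chromatic_number G = Some n -> colorable G m <-> (n <= m)%N.
Proof.
move=> /min_natE[[c c_proper] n_min]; split=> [/n_min //|nm].
exists (widen_ord nm \o c) => u v /c_proper cuv /(congr1 val) /= ?.
exact/cuv/val_inj.
Qed.

Lemma homomorphic_colorable (T T' : Type) (G : sgraph T) (H : sgraph T')
    (n : nat) :
  homomorphic G H -> colorable H n -> colorable G n.
Proof. by move=> [f fhom] [c c_proper]; exists (c \o f) => u v /fhom/c_proper. Qed.

(** Frees the colours from ['I_n], so that [n ^ k] colours can be taken as [k]-tuples of type
    [{ffun 'I_k -> 'I_n}]. *)
Lemma colorable_card (T : Type) (X : finType) (G : sgraph T) (n : nat) :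
  #|X| = n ->
  colorable G n <-> exists c : vertices G -> X,
    forall u v : vertices G, edge G (\val u) (\val v) -> c u <> c v.
Proof.
move=> <-; split=> -[c c_proper].
  by exists (enum_val \o c) => u v /c_proper cuv /enum_val_inj/cuv.
by exists (enum_rank \o c) => u v /c_proper cuv /enum_rank_inj/cuv.
Qed.

Section Cut.
Variables (T X : Type) (G : sgraph T) (d : vertices G -> X).

(** As [d] is defined only on the subtype of vertices, the ambient points [x], [y] are lifted to
    [u], [v] before being coloured. *)
Definition cut_edge (x y : T) : Prop :=
  exists u v : vertices G,
    [/\ \val u = x, \val v = y, edge G x y & d u <> d v].

Let cut_edge_vertices x y : cut_edge x y -> vertices G x.
Proof. by move=> [u [v [_ _ xy _]]]; exact: edge_vertices xy. Qed.

Let cut_edge_sym x y : cut_edge x y -> cut_edge y x.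
Proof.
by move=> [u [v [ux vy xy /nesym dvu]]]; exists v, u; split=> //; exact: edge_sym.
Qed.

Let cut_edge_irrefl x : ~ cut_edge x x.
Proof. by move=> [u [v [_ _ xx _]]]; exact: edge_irrefl xx. Qed.

Definition cut_graph : sgraph T :=
  SGraph cut_edge_vertices cut_edge_sym cut_edge_irrefl.

Lemma cut_graph_subgraph : subgraph cut_graph G.
Proof. by split=> // x y [u [v []]]. Qed.

End Cut.

Lemma cut_graph_homomorphic (T : Type) (G : sgraph T) (n : nat)
    (d : vertices G -> 'I_n) :
  homomorphic (cut_graph d) (complete_graph n).
Proof.
exists (fun u => exist _ (d u) (mem_set I)) => u v [u' [v' [uu' vv' _]]].
by rewrite (val_inj uu') (val_inj vv').
Qed.

(** Distinct tuples differ in some coordinate [i], so each edge survives in the [i]-th cut. *)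
Lemma graph_union_cut (T X : Type) (G : sgraph T) (k : nat)
    (c : vertices G -> {ffun 'I_k -> X}) :
  (0 < k)%N ->
  (forall u v : vertices G, edge G (\val u) (\val v) -> c u <> c v) ->
  G = graph_union (fun i => cut_graph (fun u => c u i)).
Proof.
move=> k_gt0 c_proper; apply: sgraph_ext => [|x y].
  (* Every cut keeps all vertices of [G], so one index suffices; an empty union would have none. *)
  by apply/seteqP; split=> [x Gx|x [] //]; exists (Ordinal k_gt0).
split=> [xy|[i [u [v [_ _ //]]]]].
have yx := edge_sym xy.
pose u : vertices G := exist _ x (mem_set (edge_vertices xy)).
pose v : vertices G := exist _ y (mem_set (edge_vertices yx)).
have /existsNP[i cuv] : ~ forall i, c u i = c v i.
  by move=> cuv; apply: (c_proper u v xy); exact/ffunP.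
by exists i, u, v.
Qed.

Definition hom_coverable (T T' : Type) (G : sgraph T) (H : sgraph T')
    (k : nat) : Prop :=
  exists G_ : 'I_k -> sgraph T,
    [/\ forall i, subgraph (G_ i) G,
        G = graph_union G_ &
        forall i, homomorphic (G_ i) H].

Lemma hom_coverable_colorable (T T' : Type) (G : sgraph T) (H : sgraph T')
    (n k : nat) :
  (0 < n)%N -> colorable H n -> hom_coverable G H k -> colorable G (n ^ k).
Proof.
move=> n_gt0 Hn [G_ [_ GE G_H]].
have G_edge x y : edge G x y -> union_edge G_ x y by rewrite GE.
have col i := cid (homomorphic_colorable (G_H i) Hn).
(* A vertex outside [G_ i] gets the default colour 0. This is harmless: an edge is separated at an
   index [i] for which it lies in [G_ i], hence so do both its ends. *)
pose e i (x : T) : 'I_n :=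
  if insub x is Some u then sval (col i) u else Ordinal n_gt0.
apply/(@colorable_card _ {ffun 'I_k -> 'I_n}); first by rewrite card_ffun !card_ord.
exists (fun u => [ffun i => e i (\val u)]) => u v.
move=> /G_edge[i uv] /ffunP/(_ i); rewrite !ffunE /e.
have ui := mem_set (edge_vertices uv).
have vi := mem_set (edge_vertices (edge_sym uv)).
case: insubP => [u' _ uu'|/negP//]; case: insubP => [v' _ vv'|/negP//].
by apply: (svalP (col i)); rewrite uu' vv'.
Qed.

Lemma colorable_hom_coverable (T T' : Type) (G : sgraph T) (H : sgraph T')
    (n k : nat) :
  (0 < k)%N -> homomorphic (complete_graph n) H -> colorable G (n ^ k) ->
  hom_coverable G H k.
Proof.
move=> k_gt0 nH.
move=> /(@colorable_card _ {ffun 'I_k -> 'I_n})[|c c_proper].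
  by rewrite card_ffun !card_ord.
exists (fun i => cut_graph (fun u => c u i)); split.
- by move=> i; exact: cut_graph_subgraph.
- exact: graph_union_cut.
- by move=> i; exact: homomorphic_trans (cut_graph_homomorphic _) nH.
Qed.

(** Since [ln b] is positive, comparing a logarithm with an integer amounts to comparing powers;
    ceilings and floors thus reduce to inequalities in [nat]. *)
Lemma log_base_le (R : realType) (b x : R) (k : nat) :
  1 < b -> 0 < x -> (log_base b x <= k%:R) = (x <= b ^+ k).
Proof.
move=> b_gt1 x_gt0; have b_gt0 := lt_trans ltr01 b_gt1.
rewrite /log_base ler_pdivrMr ?ln_gt0 // mulr_natl -lnXn //.
by rewrite ler_ln ?posrE ?exprn_gt0.
Qed.

Lemma log_base_ge (R : realType) (b x : R) (k : nat) :
  1 < b -> 0 < x -> (k%:R <= log_base b x) = (b ^+ k <= x).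
Proof.
move=> b_gt1 x_gt0; have b_gt0 := lt_trans ltr01 b_gt1.
rewrite /log_base ler_pdivlMr ?ln_gt0 // mulr_natl -lnXn //.
by rewrite ler_ln ?posrE ?exprn_gt0.
Qed.

Lemma ceil_log_base (R : realType) (b n k : nat) :
  (1 < b)%N -> (b ^ k < n <= b ^ k.+1)%N ->
  Num.ceil (log_base (b%:R : R) n%:R) = k.+1%:Z.
Proof.
move=> b_gt1 /andP[kn nk]; have n_gt0 := leq_ltn_trans (leq0n _) kn.
have kE : k.+1%:Z - 1 = k by rewrite -addn1 PoszD addrK.
apply: ceil_def; rewrite kE -!pmulrn.
by rewrite ltNge !log_base_le ?ltr1n ?ltr0n // -!natrX !ler_nat -ltnNge kn.
Qed.

Lemma floor_log_base (R : realType) (b n k : nat) :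
  (1 < b)%N -> (b ^ k < n <= b ^ k.+1)%N ->
  Num.floor (log_base (b%:R : R) (b%:R * (n%:R - 1))) = k.+1%:Z.
Proof.
(* From here [n] is the predecessor of the original one, so [b ^ k <= n < b ^ k.+1]; multiplying by
   [b] gives the bounds required for the floor. *)
move=> b_gt1 /andP[]; case: n => // n; rewrite ltnS => kn nk.
have b_gt0 := ltnW b_gt1.
have n_gt0 : (0 < n)%N by apply: leq_trans kn; rewrite expn_gt0 b_gt0.
rewrite -[n.+1]addn1 natrD addrK -natrM.
have kE : k.+1%:Z + 1 = k.+2 by rewrite -PoszD addn1.
apply: floor_def; rewrite kE -!pmulrn.
rewrite ltNge !log_base_ge ?ltr1n ?ltr0n ?muln_gt0 ?b_gt0 //.
by rewrite -!natrX !ler_nat -ltnNge expnS leq_pmul2l // kn expnS ltn_pmul2l.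
Qed.

Unset Implicit Arguments.

Theorem corollary3p34 (R : realType) (T T' : Type)
    (G : sgraph T) (H : sgraph T') (chiG chiH : nat)
    (chiGE : chromatic_number G = Some chiG)
    (chiHE : chromatic_number H = Some chiH)
    (omegaHE : clique_number H = chromatic_number H)
    (chiG_ge2 : (2 <= chiG)%N)
    (chiH_ge2 : (2 <= chiH)%N) :
  exists C : nat,
    [/\ hom_complexity G H = Some C,
        min_nat [set k : nat | (1 <= k)%N /\ (chiG <= chiH ^ k)%N] = Some C,
        C%:Z = Num.ceil (log_base (chiH%:R : R) chiG%:R),
        max_nat [set m : nat | (1 <= m)%N /\ (chiH ^ m.-1 + 1 <= chiG)%N]
          = Some C &
        C%:Z = Num.floor (log_base (chiH%:R : R) (chiH%:R * (chiG%:R - 1)))].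
Proof.
have coverE k : (0 < k)%N -> hom_coverable G H k <-> (chiG <= chiH ^ k)%N.
  move=> k_gt0; rewrite -(chromatic_number_le _ chiGE); split.
    apply: hom_coverable_colorable; first exact: ltnW.
    exact/(chromatic_number_le _ chiHE).
  apply: colorable_hom_coverable => //.
  (* The equality of clique and chromatic numbers supplies a complete graph on [chiH] vertices
     inside [H]. *)
  by apply: clique_number_homomorphic; rewrite omegaHE.
have bounds := up_log_bounds chiH_ge2 chiG_ge2.
(* The common value is [up_log chiH chiG], positive because [chiG] is at least 2; writing it [k.+1]
   gives [chiH ^ k < chiG <= chiH ^ k.+1]. *)
case: (up_log chiH chiG) (up_log_gt0 chiH chiG) bounds => [|k _ /= kE].
  by rewrite chiH_ge2 chiG_ge2.
have /andP[kG Gk] := kE.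
exists k.+1; split.
- apply/min_natE; split=> [|j [j_gt0 /(coverE _ j_gt0) Gj]].
    by split=> //; exact/coverE.
  by rewrite -(ltn_exp2l _ _ chiH_ge2); exact: leq_trans Gj.
- apply/min_natE; split=> // j [_ Gj].
  by rewrite -(ltn_exp2l _ _ chiH_ge2); exact: leq_trans Gj.
- by rewrite (@ceil_log_base _ _ _ k).
- apply/max_natE; split=> [|[|j] // [_]]; rewrite /= addn1 // => jG.
  (* Here [m] is [j.+1], and [chiH ^ j < chiG <= chiH ^ k.+1] forces [j < k.+1]. *)
  by rewrite -(ltn_exp2l _ _ chiH_ge2); exact: leq_trans Gk.
- by rewrite (@floor_log_base _ _ _ k).
Qed.
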